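(* Let $A_1,A_2,\ldots,A_k\in\mathbb{C}^{n\times n}$ be pairwise commuting matrices. Then $$\sigma_T(A_1,A_2,\ldots,A_k)=\Big\{(z_1,z_2,\ldots,z_k)\in\mathbb{C}^k:\ \text{the matrix polynomial }\sum_{i=1}^k(A_i-z_iI)\lambda^{i-1}\text{ is singular}\Big\}.$$
   Context: A matrix polynomial $P(\lambda)=\sum_{i=1}^k P_i\lambda^{i-1}$ is singular if $P(\lambda_0)$ is not invertible for every $\lambda_0\in\mathbb{C}$. Taylor spectrum: let $\mathcal{H}$ be a complex Hilbert space (here $\mathcal{H}=\mathbb{C}^n$). Let $\Lambda[s]$ be the free complex algebra generated by indeterminates $s_1,\ldots,s_k$ with product $\wedge$ satisfying $s_i\wedge s_j=-s_j\wedge s_i$ (the exterior algebra). For $F=\{i_1<\ldots<i_p\}\subset\{1,\ldots,k\}$ put $s_F=s_{i_1}\wedge\ldots\wedge s_{i_p}$, and let $\Lambda^p[s,\mathcal{H}]=\{\sum_{\#F=p}x_Fs_F: x_F\in\mathcal{H}\}$. For a commuting tuple $\mathbf{T}=(T_1,\ldots,T_k)$ of bounded operators on $\mathcal{H}$, let $\delta^p_{\mathbf{T}}:\Lambda^p[s,\mathcal{H}]\to\Lambda^{p+1}[s,\mathcal{H}]$, $\delta^p_{\mathbf{T}}(\sum_Fx_Fs_F)=\sum_{i=1}^k\sum_F(T_ix_F)\,s_i\wedge s_F$, for $0\le p\le k-1$; let $\delta^{-1}_{\mathbf{T}}:\{0\}\to\Lambda^0[s,\mathcal{H}]$ and $\delta^k_{\mathbf{T}}:\Lambda^k[s,\mathcal{H}]\to\{0\}$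 be the zero maps. The Koszul complex $K(\mathbf{T},\mathcal{H})$ formed by these maps is exact if the range of $\delta^{i-1}_{\mathbf{T}}$ equals $\ker\delta^i_{\mathbf{T}}$ for all $i=0,1,\ldots,k$. The Taylor spectrum is $\sigma_T(T_1,\ldots,T_k)=\{(\lambda_1,\ldots,\lambda_k)\in\mathbb{C}^k: K((T_1-\lambda_1,\ldots,T_k-\lambda_k),\mathcal{H})\text{ is not exact}\}$. *)

(* Defs.v *)
(* Mathematical Components, with the sets of MathComp-Analysis. *)
From HB Require Import structures.
From mathcomp Require Import all_boot all_order all_algebra.
From mathcomp Require Import classical_sets reals complex.
Set Implicit Arguments.
Unset Strict Implicit.
Unset Printing Implicit Defensive.
Import Order.TTheory GRing.Theory Num.Theory.
Local Open Scope ring_scope.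

(* Indices run over 'I_k, i.e. from 0 to k - 1 instead of from 1 to k. *)

(* An element a of the exterior algebra on s_0, ..., s_(k-1) is given by its
   coordinates a F on the monomials s_F, where s_F is the product of the s_i,
   i in F, in increasing order. *)
Notation extalg C k := {ffun {set 'I_k} -> C^o}.

(* The monomial s_F. *)
Definition smon (C : fieldType) k (F : {set 'I_k}) : extalg C k :=
  [ffun G => (G == F)%:R].

Definition sgen (C : fieldType) k (i : 'I_k) : extalg C k := smon C [set i]%SET.

(* The number of transpositions of adjacent generators that sort the
   concatenation of the increasing enumerations of F and G. *)
Definition inversions k (F G : {set 'I_k}) : nat :=
  (\sum_(i in F) \sum_(j in G) (j < i))%N.

Definition wedge_mon (C : fieldType) k (F G : {set 'I_k}) : extalg C k :=
  if [disjoint F & G] then (-1) ^+ inversions F G *: smon C (F :|: G) else 0.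

Definition wedge (C : fieldType) k (a b : extalg C k) : extalg C k :=
  \sum_F \sum_G (a F * b G) *: wedge_mon C F G.

(* An element x of Lambda[s, C^n] is given by its coefficients: it stands for
   the sum over F of (x F) s_F. *)
Notation extmod C n k := {ffun {set 'I_k} -> 'cV[C]_n}.

(* The element v a of Lambda[s, C^n], for v in C^n and a in Lambda[s]. *)
Definition vext (C : fieldType) n k (v : 'cV[C]_n) (a : extalg C k) :
  extmod C n k := [ffun F => a F *: v].

(* Lambda^p[s, C^n]. The degree is an integer so that the end terms of the
   Koszul complex, in degrees -1 and k + 1, are included; they are null
   (lemmas ext_degN1 and ext_deg_gt). *)
Definition ext_deg (C : fieldType) n k (p : int) : set (extmod C n k) :=
  [set x | forall F : {set 'I_k}, x F != 0 -> #|F|%:Z = p]%classic.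

(* The map delta_T on all of Lambda[s, C^n]; delta_T^p is its restriction to
   Lambda^p[s, C^n], which takes values in Lambda^(p+1)[s, C^n]
   (lemma koszul_diff_deg). *)
Definition koszul_diff (C : fieldType) n k (T : 'I_k -> 'M[C]_n)
    (x : extmod C n k) : extmod C n k :=
  \sum_(i < k) \sum_(F : {set 'I_k})
    vext (T i *m x F) (wedge (sgen C i) (smon C F)).

Definition koszul_range (C : fieldType) n k (T : 'I_k -> 'M[C]_n) (p : int) :
  set (extmod C n k) := (koszul_diff T @` @ext_deg C n k p)%classic.

Definition koszul_ker (C : fieldType) n k (T : 'I_k -> 'M[C]_n) (p : int) :
  set (extmod C n k) :=
  [set x | ext_deg p x /\ koszul_diff T x = 0]%classic.

Definition koszul_exact (C : fieldType) n k (T : 'I_k -> 'M[C]_n) : Prop :=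
  forall p : nat, (p <= k)%N -> koszul_range T (p%:Z - 1) = koszul_ker T p%:Z.

Definition taylor_spectrum (C : fieldType) n k (T : 'I_k -> 'M[C]_n) :
  set 'rV[C]_k :=
  [set z | ~ koszul_exact (fun i => T i - (z 0 i)%:M)]%classic.

Definition matpoly (C : fieldType) n k (P : 'I_k -> 'M[C]_n) :
  'M[{poly C}]_n := \sum_(i < k) 'X^i *: map_mx polyC (P i).

Definition matpoly_eval (C : fieldType) n (P : 'M[{poly C}]_n) (l : C) :
  'M[C]_n := map_mx (horner_eval l) P.

Definition matpoly_singular (C : fieldType) n (P : 'M[{poly C}]_n) : Prop :=
  forall l : C, matpoly_eval P l \notin unitmx.

Lemma matpoly_evalE (C : fieldType) n k (P : 'I_k -> 'M[C]_n) (l : C) :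
  matpoly_eval (matpoly P) l = \sum_(i < k) l ^+ i *: P i.
Proof.
apply/matrixP=> a b; rewrite mxE /horner_eval !summxE horner_sum.
by apply: eq_bigr => i _; rewrite !mxE hornerM hornerXn hornerC.
Qed.

Section ExteriorAlgebra.
Variables (C : fieldType) (k : nat).
Implicit Types (F G H : {set 'I_k}) (a b c : extalg C k).

Lemma extalgE a : a = \sum_F a F *: smon C F.
Proof.
apply/ffunP=> G; rewrite sum_ffunE (bigD1 G) //= big1 => [|F /negPf nFG].
  by rewrite !ffunE eqxx addr0 /GRing.scale /= mulr1.
by rewrite !ffunE eq_sym nFG /GRing.scale /= mulr0.
Qed.

Lemma wedge_smon F G : wedge (smon C F) (smon C G) = wedge_mon C F G.
Proof.
rewrite /wedge (bigD1 F) //= (bigD1 G) //= !ffunE !eqxx mulr1 scale1r.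
rewrite big1 => [|H /negPf nH]; last by rewrite !ffunE nH mulr0 scale0r.
rewrite addr0 big1 ?addr0 // => H /negPf nH.
by rewrite big1 // => J _; rewrite !ffunE nH mul0r scale0r.
Qed.

Lemma wedgeDl a b c : wedge (a + b) c = wedge a c + wedge b c.
Proof.
rewrite /wedge -big_split; apply: eq_bigr => F _ /=.
rewrite -big_split; apply: eq_bigr => G _ /=.
by rewrite ffunE mulrDl scalerDl.
Qed.

Lemma wedgeDr a b c : wedge a (b + c) = wedge a b + wedge a c.
Proof.
rewrite /wedge -big_split; apply: eq_bigr => F _ /=.
rewrite -big_split; apply: eq_bigr => G _ /=.
by rewrite ffunE mulrDr scalerDl.
Qed.

Lemma wedgeZl t a b : wedge (t *: a) b = t *: wedge a b.
Proof.
rewrite /wedge scaler_sumr; apply: eq_bigr => F _ /=.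
rewrite scaler_sumr; apply: eq_bigr => G _ /=.
by rewrite ffunE scalerA mulrA.
Qed.

Lemma wedgeZr t a b : wedge a (t *: b) = t *: wedge a b.
Proof.
rewrite /wedge scaler_sumr; apply: eq_bigr => F _ /=.
rewrite scaler_sumr; apply: eq_bigr => G _ /=.
by rewrite ffunE scalerA mulrCA.
Qed.

Lemma wedge0l a : wedge 0 a = 0.
Proof. by have := wedgeZl 0 0 a; rewrite !scale0r. Qed.

Lemma wedge0r a : wedge a 0 = 0.
Proof. by have := wedgeZr 0 a 0; rewrite !scale0r. Qed.

Lemma wedge_suml (I : finType) (f : I -> extalg C k) b :
  wedge (\sum_i f i) b = \sum_i wedge (f i) b.
Proof.
elim/big_ind2: _ => [|x a y c <- <-|//]; [exact: wedge0l | exact: wedgeDl].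
Qed.

Lemma wedge_sumr (I : finType) (f : I -> extalg C k) b :
  wedge b (\sum_i f i) = \sum_i wedge b (f i).
Proof.
elim/big_ind2: _ => [|x a y c <- <-|//]; [exact: wedge0r | exact: wedgeDr].
Qed.

Lemma sum_disjU F G (f : 'I_k -> nat) : [disjoint F & G] ->
  (\sum_(i in F :|: G) f i = \sum_(i in F) f i + \sum_(i in G) f i)%N.
Proof.
by move=> dFG; rewrite -bigU //=; apply: eq_bigl => i; rewrite inE.
Qed.

Lemma inversionsUl F G H : [disjoint F & G] ->
  inversions (F :|: G) H = (inversions F H + inversions G H)%N.
Proof. by move=> dFG; rewrite /inversions sum_disjU. Qed.

Lemma inversionsUr F G H : [disjoint G & H] ->
  inversions F (G :|: H) = (inversions F G + inversions F H)%N.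
Proof.
move=> dGH; rewrite /inversions -big_split; apply: eq_bigr => i _ /=.
by rewrite sum_disjU.
Qed.

Lemma disjointUr F G H :
  [disjoint F & G :|: H] = [disjoint F & G] && [disjoint F & H].
Proof. by rewrite -!finset.setI_eq0 finset.setIUr finset.setU_eq0. Qed.

Lemma disjointUl F G H :
  [disjoint F :|: G & H] = [disjoint F & H] && [disjoint G & H].
Proof. by rewrite -!finset.setI_eq0 finset.setIUl finset.setU_eq0. Qed.

Lemma wedge_smonA F G H :
  wedge (smon C F) (wedge (smon C G) (smon C H)) =
  wedge (wedge (smon C F) (smon C G)) (smon C H).
Proof.
rewrite !wedge_smon /wedge_mon.
case: (boolP [disjoint G & H]) => dGH; case: (boolP [disjoint F & G]) => dFG;
  rewrite ?wedge0l ?wedge0r ?wedgeZl ?wedgeZr ?wedge_smon /wedge_mon //.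
- rewrite disjointUr disjointUl dGH dFG andbT /=.
  case: ifP => _; last by rewrite !scaler0.
  rewrite !scalerA -!exprD finset.setUA inversionsUl // inversionsUr //.
  by congr ((-1) ^+ _ *: _); rewrite [LHS]addnC -addnA.
- by rewrite disjointUr (negPf dFG) /= scaler0.
- by rewrite disjointUl (negPf dGH) andbF /= scaler0.
Qed.

Lemma extalg_linP (f g : extalg C k -> extalg C k) :
    (forall a b, f (a + b) = f a + f b) -> (forall t a, f (t *: a) = t *: f a) ->
    (forall a b, g (a + b) = g a + g b) -> (forall t a, g (t *: a) = t *: g a) ->
  (forall F, f (smon C F) = g (smon C F)) -> forall a, f a = g a.
Proof.
move=> fD fZ gD gZ eq_fg a.
have f0 : f 0 = 0 by have := fZ 0 0; rewrite !scale0r.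
have g0 : g 0 = 0 by have := gZ 0 0; rewrite !scale0r.
rewrite (extalgE a) (big_morph f fD f0) (big_morph g gD g0).
by apply: eq_bigr => F _; rewrite fZ gZ eq_fg.
Qed.

Lemma wedgeA a b c : wedge a (wedge b c) = wedge (wedge a b) c.
Proof.
pose L := (wedgeDl, wedgeDr); pose Z := (wedgeZl, wedgeZr).
apply: (extalg_linP (f := fun x => wedge x _) (g := fun x => wedge (wedge x _) _))
  => [x y|t x|x y|t x|F]; rewrite ?L ?Z //.
apply: (extalg_linP (f := fun x => wedge _ (wedge x _))
                    (g := fun x => wedge (wedge _ x) _))
  => [x y|t x|x y|t x|G]; rewrite ?L ?Z //.
apply: (extalg_linP (f := fun x => wedge _ (wedge _ x)) (g := fun x => wedge _ x))
  => [x y|t x|x y|t x|H]; rewrite ?L ?Z //.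
exact: wedge_smonA.
Qed.

Lemma wedge_sgenC (i j : 'I_k) :
  wedge (sgen C i) (sgen C j) = - wedge (sgen C j) (sgen C i).
Proof.
rewrite !wedge_smon /wedge_mon.
rewrite !disjoints1 !inE /inversions !big_set1 eq_sym.
have [_|nij] := eqVneq j i; first by rewrite oppr0.
rewrite finset.setUC -scaleNr; congr (_ *: _).
have : (i : nat) != j by rewrite eq_sym.
by case: ltngtP; rewrite ?expr1 ?expr0 ?opprK.
Qed.

Lemma wedge1l a : wedge (smon C finset.set0) a = a.
Proof.
rewrite [in RHS](extalgE a) [in LHS](extalgE a) wedge_sumr.
apply: eq_bigr => F _; rewrite wedgeZr wedge_smon /wedge_mon.
by rewrite -finset.setI_eq0 finset.set0I eqxx /inversions big_set0 scale1r
  finset.set0U.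
Qed.

Lemma wedge_sgen_smon (i : 'I_k) F :
  wedge (sgen C i) (smon C F) =
  if i \in F then 0 else (-1) ^+ (\sum_(j in F) (j < i))%N *: smon C (i |: F).
Proof.
by rewrite wedge_smon /wedge_mon disjoints1 /inversions big_set1; case: (i \in F).
Qed.

Lemma smon_sorted (s : seq 'I_k) :
  sorted (fun i j : 'I_k => (i < j)%N) s ->
  foldr (fun i => wedge (sgen C i)) (smon C finset.set0) s =
  smon C [set:: s]%SET.
Proof.
have lt_trans : transitive (fun i j : 'I_k => (i < j)%N).
  by move=> j i l; apply: ltn_trans.
elim: s => [_|i s IHs]; first by rewrite finset.set_nil.
rewrite /= path_sortedE // => /andP[/allP lt_i /IHs ->].
rewrite wedge_sgen_smon inE ifN; last first.
  by apply/negP => /lt_i; rewrite ltnn.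
rewrite finset.set_cons big1 ?expr0 ?scale1r // => j; rewrite inE => /lt_i.
by case: ltngtP.
Qed.

Lemma smon_enum F :
  smon C F = foldr (fun i => wedge (sgen C i)) (smon C finset.set0) (enum F).
Proof.
rewrite smon_sorted ?set_enum // /enum_mem sorted_filter //.
  by move=> j i l; apply: ltn_trans.
have := iota_ltn_sorted 0 k; rewrite -val_enum_ord sorted_map.
by rewrite enumT.
Qed.

End ExteriorAlgebra.

Section Koszul.
Variables (C : fieldType) (n k : nat).

Lemma ext_degN1 : @ext_deg C n k (- 1) = [set 0]%classic.
Proof.
apply/seteqP; split=> x /= => [dx|-> F]; last by rewrite ffunE eqxx.
apply/ffunP=> F; rewrite ffunE; apply/eqP; apply: contraT => /dx.
by [].
Qed.

Lemma ext_deg_gt (p : nat) :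
  (k < p)%N -> @ext_deg C n k p%:Z = [set 0]%classic.
Proof.
move=> lt_kp; apply/seteqP; split=> x /= => [dx|-> F]; last first.
  by rewrite ffunE eqxx.
apply/ffunP=> F; rewrite ffunE; apply/eqP; apply: contraT => /dx [def_p].
by have := max_card (mem F); rewrite def_p card_ord leqNgt lt_kp.
Qed.

Lemma koszul_diff_deg (T : 'I_k -> 'M[C]_n) (p : int) (x : extmod C n k) :
  ext_deg p x -> ext_deg (p + 1) (koszul_diff T x).
Proof.
move=> dx G; apply: contraNeq => neq_p; rewrite !sum_ffunE.
rewrite big1 // => i _; rewrite sum_ffunE big1 // => F _; rewrite ffunE.
have [->|/dx dF] := eqVneq (x F) 0; first by rewrite mulmx0 scaler0.
rewrite wedge_sgen_smon; case: ifPn => iF; first by rewrite ffunE scale0r.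
rewrite !ffunE; case: eqP => [defG|_]; last by rewrite scaler0 scale0r.
by case/eqP: neq_p; rewrite defG cardsU1 iF -dF addrC.
Qed.

End Koszul.

(* Main.v *)
(* For commuting B_i = A_i - z_i, both conditions say that the B_i have a common
   null vector.

   - If P(X) = sum_i X^i B_i has zero determinant, it kills a nonzero vector v
     of polynomials. If some B_i v is nonzero, then for the first such i the
     vector B_i v / X is again killed by P and has lower degree than v, so by
     descent P kills a nonzero v with all B_i v = 0; any nonzero coefficient
     of this v is a common null vector.
   - If S = P(l) = sum_i l^i B_i is invertible, then the contraction
     h = sum_i l^i d_i, with d_i the annihilation operator dual to s_i,
     satisfies delta h + h delta = S by the canonical anticommutation
     relations, so S^-1 h is a contracting homotopy of the Koszul complex.
   - A common null vector is a cycle of degree 0, hence not a boundary. *)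

From HB Require Import structures.
Require Import Defs.
From mathcomp Require Import all_boot all_order all_algebra.
From mathcomp Require Import classical_sets reals complex.
Set Implicit Arguments.
Unset Strict Implicit.
Unset Printing Implicit Defensive.
Import GRing.Theory.
Local Open Scope ring_scope.

(** * Singular matrix polynomials and common null vectors *)

Section JointKernel.
Variables (C : fieldType) (n k : nat) (B : 'I_k -> 'M[C]_n).

Definition joint_null_vector :=
  exists2 u : 'cV[C]_n, u != 0 & forall i, B i *m u = 0.

Lemma cV_neq0P (R : nzRingType) (v : 'cV[R]_n) :
  v != 0 -> exists a, v a 0 != 0.
Proof.
move=> nz_v; apply/existsP; apply: contraR nz_v => /existsPn v0.
by apply/eqP/colP=> a; rewrite mxE; apply/eqP; rewrite -[_ == _]negbK v0.
Qed.

Lemma matpoly_mul (v : 'cV[{poly C}]_n) :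
  matpoly B *m v = \sum_(i < k) 'X^i *: (map_mx polyC (B i) *m v).
Proof.
by rewrite mulmx_suml; apply: eq_bigr => i _; rewrite scalemxAl.
Qed.

Lemma coef_map_polyC_mul (M : 'M[C]_n) (v : 'cV[{poly C}]_n) m :
  map_mx (coefp m) (map_mx polyC M *m v) = M *m map_mx (coefp m) v.
Proof.
apply/colP=> a; rewrite !mxE /= coef_sum; apply: eq_bigr => b _.
by rewrite !mxE coefCM.
Qed.

Lemma size_map_polyC_mul (M : 'M[C]_n) (v : 'cV[{poly C}]_n) d :
  (forall a, (size (v a 0%R) <= d)%N) ->
  forall a, (size ((map_mx polyC M *m v) a 0%R) <= d)%N.
Proof.
move=> size_v a; rewrite mxE; apply: leq_trans (size_sum _ _ _) _.
apply/bigmax_leqP => b _; rewrite mxE mul_polyC.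
exact: leq_trans (size_scale_leq _ _) (size_v b).
Qed.

Hypothesis commB : forall i j, comm_mx (B i) (B j).

Lemma matpoly_ker_joint_null d (v : 'cV[{poly C}]_n) :
  (forall a, (size (v a 0%R) <= d)%N) -> v != 0 -> matpoly B *m v = 0 ->
  joint_null_vector.
Proof.
pose Bp i := map_mx polyC (B i).
(* The bound [d] is on sizes, one more than degrees, so [d = 0] would force [v = 0]. *)
elim: d v => [|d IHd] v size_v nz_v Pv0.
  have [a] := cV_neq0P nz_v.
  by have := size_v a; rewrite leqn0 size_poly_eq0 => ->.
case: (altP (@forallP _ (fun i => Bp i *m v == 0))) => [Bv0|].
  have [a nz_va] := cV_neq0P nz_v.
  (* At the degree of the nonzero entry [v a 0], the coefficient vector has the leading coefficient
     of that entry in row [a]. *)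
  exists (map_mx (coefp (size (v a 0)).-1) v).
    apply: contraNneq nz_va => /colP/(_ a); rewrite !mxE /= => /eqP.
    by rewrite -/(lead_coef _) lead_coef_eq0.
  by move=> i; rewrite -coef_map_polyC_mul (eqP (Bv0 i)) map_mx0.
case/forallPn=> i0 nz_i0.
case: (@arg_minnP _ i0 (fun i => Bp i *m v != 0) val nz_i0) => i nz_i min_i.
(* Compare coefficients of ['X^i] in [matpoly B *m v = 0]: the terms [j < i] vanish by minimality of
   [i], the terms [j > i] start in higher degree, so the constant term of [Bp i *m v] is zero. *)
have Biv_divX a : (Bp i *m v) a 0 = 'X * drop_poly 1 ((Bp i *m v) a 0).
  rewrite -[LHS](poly_take_drop 1) expr1 [in RHS]mulrC -[RHS]add0r.
  congr (_ + _); apply/polyP=> m; rewrite coef_take_poly coef0.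
  case: m => //=; move/matrixP: Pv0 => /(_ a 0).
  rewrite matpoly_mul summxE mxE => /(congr1 (coefp i)) /=.
  rewrite coef_sum coef0 (bigD1 i) //= big1 => [|j ne_ji].
    by rewrite mxE coefXnM ltnn subnn addr0.
  rewrite mxE coefXnM; case: ltnP => // le_ji.
  have: ~~ (i <= j)%N.
    by apply: contra ne_ji => le_ij; rewrite -val_eqE eqn_leq le_ij le_ji.
  move/(contra (min_i j)); rewrite negbK => /eqP Bj0.
  by rewrite -/(Bp j) Bj0 mxE coef0.
pose w := map_mx (drop_poly 1) (Bp i *m v).
have def_w : Bp i *m v = 'X *: w.
  by apply/colP=> a; rewrite Biv_divX [RHS]mxE [w a 0]mxE.
apply: (IHd w) => [a||].
- rewrite mxE size_drop_poly leq_subLR add1n.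
  exact: size_map_polyC_mul.
- by apply: contraNneq nz_i => w0; rewrite def_w w0 scaler0.
(* [Bp i] commutes with the whole polynomial, so ['X *: w] is still killed; the factor ['X] then
   cancels entrywise, as polynomials form a domain. *)
have Pw0 : 'X *: (matpoly B *m w) = 0.
  rewrite scalemxAr -def_w mulmxA.
  have -> : matpoly B *m Bp i = Bp i *m matpoly B.
    rewrite mulmx_suml mulmx_sumr; apply: eq_bigr => j _.
    rewrite -scalemxAl -scalemxAr -!map_mxM; congr (_ *: map_mx _ _).
    exact: commB.
  by rewrite -mulmxA Pv0 mulmx0.
apply/colP=> a; have /colP/(_ a) := Pw0; rewrite !mxE => /eqP.
by rewrite mulf_eq0 polyX_eq0 /= => /eqP.
Qed.

Lemma det_matpoly_joint_null : \det (matpoly B) = 0 -> joint_null_vector.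
Proof.
(* [det0P] yields a row vector killed from the left, hence the transpose. *)
move=> detP0; have /det0P[v nz_v vP0] : \det (matpoly B)^T == 0.
  by rewrite det_tr detP0.
apply: (@matpoly_ker_joint_null (\max_a size (v^T a 0%R))%N v^T) => [a||].
- exact: (leq_bigmax a).
- by rewrite -(inj_eq trmx_inj) trmxK trmx0.
by apply: trmx_inj; rewrite trmx_mul trmxK vP0 trmx0.
Qed.

End JointKernel.

(** A nonzero determinant would have a nonroot [l], at which the evaluated matrix is invertible.
    Conversely, a common null vector is killed by every evaluation. *)
Lemma matpoly_singularP (C : closedFieldType) n k (B : 'I_k -> 'M[C]_n) :
  (forall i j, comm_mx (B i) (B j)) ->
  matpoly_singular (matpoly B) <-> joint_null_vector B.
Proof.
move=> commB; split=> [singP | [u nz_u Bu0] l].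
  apply: det_matpoly_joint_null => //; apply/eqP/negPn/negP.
  case/closed_nonrootP=> l; have := singP l.
  by rewrite unitmxE unitfE /matpoly_eval det_map_mx => /negPn rl /negP[].
have Pu0 : matpoly_eval (matpoly B) l *m u = 0.
  rewrite matpoly_evalE mulmx_suml big1 // => i _.
  by rewrite -scalemxAl Bu0 scaler0.
by apply: contra nz_u => unitP; rewrite -(mulKmx unitP u) Pu0 mulmx0.
Qed.

(** * Creation and annihilation operators and their anticommutation relations *)

Section CAR.
Variables (C : fieldType) (n k : nat).
Implicit Types (x : extmod C n k) (F : {set 'I_k}) (i j : 'I_k).

(** The sign of moving [s_i] past the generators of [F] that precede it. *)
Definition koszul_sign F i : C := (-1) ^+ (\sum_(j in F) (j < i))%N.

(** Left wedge by [s_i], in coordinates. The sign may be taken on [F] instead of [F :\ i], since [i]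
    is not counted below itself. *)
Definition ext_create i x : extmod C n k :=
  [ffun F : {set _} => if i \in F then koszul_sign F i *: x (F :\ i) else 0].

(** Contraction with the covector dual to [s_i]. *)
Definition ext_annihil i x : extmod C n k :=
  [ffun F : {set _} => if i \in F then 0 else koszul_sign F i *: x (i |: F)].

Lemma koszul_signU1 F i j : i \notin F ->
  koszul_sign (i |: F) j = (-1) ^+ (i < j)%N * koszul_sign F j.
Proof. by move=> iF; rewrite /koszul_sign big_setU1 //= exprD. Qed.

Lemma koszul_signD1 F i j : i \in F ->
  koszul_sign (F :\ i) j = (-1) ^+ (i < j)%N * koszul_sign F j.
Proof.
move=> iF; rewrite /koszul_sign (big_setD1 i iF) /= exprD.
by rewrite signrMK.
Qed.

Lemma koszul_sign_sq F i : koszul_sign F i * koszul_sign F i = 1.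
Proof. by rewrite /koszul_sign -exprD addnn -signr_odd odd_double. Qed.

Lemma sign_ltn_opp i j : i != j ->
  (-1) ^+ (i < j)%N = - (-1) ^+ (j < i)%N :> C.
Proof.
by rewrite -val_eqE /=; case: ltngtP => // _ _; rewrite /= ?expr1 ?expr0 ?opprK.
Qed.

Lemma ext_createC i j x :
  ext_create i (ext_create j x) = - ext_create j (ext_create i x).
Proof.
apply/ffunP=> F; rewrite !ffunE !inE.
have [<-|ne_ij] := eqVneq i j; first by rewrite scaler0 if_same oppr0.
case: (boolP (i \in F)) => iF; case: (boolP (j \in F)) => jF /=;
  rewrite ?scaler0 ?oppr0 //.
rewrite !scalerA !koszul_signD1 // (sign_ltn_opp ne_ij).
rewrite finset.setDDl finset.setUC -finset.setDDl.
rewrite -scaleNr; congr (_ *: _).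
by rewrite mulNr mulrN mulrC mulrAC mulrC.
Qed.

(** Anticommutation of [ext_create i] with itself would not give this in characteristic 2. *)
Lemma ext_create_sq i x : ext_create i (ext_create i x) = 0.
Proof.
by apply/ffunP=> F; rewrite !ffunE !inE eqxx scaler0 if_same.
Qed.

(** For [i = j], exactly one summand survives at each [F], and its sign is a square. For distinct
    indices, both survive only when [i] is in [F] and [j] is not; their signs are then opposite,
    because exactly one of [i < j] and [j < i] holds. *)
Lemma ext_CAR i j x :
  ext_create i (ext_annihil j x) + ext_annihil j (ext_create i x) =
  if i == j then x else 0.
Proof.
apply/ffunP=> F; rewrite !ffunE !inE.
have [<-|ne_ij] := eqVneq i j.
  case: (boolP (i \in F)) => iF; rewrite ?add0r ?addr0 ?scalerA.
    by rewrite koszul_signD1 // ltnn mul1r koszul_sign_sq scale1r finset.setD1K.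
  by rewrite koszul_signU1 // ltnn mul1r koszul_sign_sq scale1r finset.setU1K.
rewrite /= ffunE.
case: (boolP (i \in F)) => iF; case: (boolP (j \in F)) => jF;
  rewrite ?andbT ?andbF ?scaler0 ?addr0 //=.
rewrite !scalerA koszul_signD1 // koszul_signU1 // (sign_ltn_opp ne_ij).
have -> : (j |: F) :\ i = j |: (F :\ i).
  by apply/finset.setP=> m; rewrite !inE; case: eqVneq => // ->;
    rewrite (negPf ne_ij).
rewrite -scalerDl mulNr mulrN [X in - X]mulrC mulrAC [X in _ + X]mulrC.
by rewrite addNr scale0r.
Qed.

End CAR.

(** * The Koszul differential and its contracting homotopy *)

Section Koszul.
Variables (C : fieldType) (n k : nat).
Implicit Types (x : extmod C n k) (F : {set 'I_k}) (i j : 'I_k) (M : 'M[C]_n).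

Definition ext_mul M x : extmod C n k := [ffun F => M *m x F].

Lemma ext_create_is_linear i : linear (@ext_create C n k i).
Proof.
move=> t x y; apply/ffunP=> F; rewrite !ffunE.
by case: ifP => _; rewrite ?scaler0 ?addr0 // scalerDr !scalerA mulrC.
Qed.

Lemma ext_annihil_is_linear i : linear (@ext_annihil C n k i).
Proof.
move=> t x y; apply/ffunP=> F; rewrite !ffunE.
by case: ifP => _; rewrite ?scaler0 ?addr0 // scalerDr !scalerA mulrC.
Qed.

Lemma ext_mul_is_linear M : linear (ext_mul M).
Proof.
by move=> t x y; apply/ffunP=> F; rewrite !ffunE mulmxDr -scalemxAr.
Qed.

HB.instance Definition _ i :=
  GRing.isLinear.Build C _ _ _ (@ext_create C n k i) (ext_create_is_linear i).
HB.instance Definition _ i :=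
  GRing.isLinear.Build C _ _ _ (@ext_annihil C n k i) (ext_annihil_is_linear i).
HB.instance Definition _ M :=
  GRing.isLinear.Build C _ _ _ (ext_mul M) (ext_mul_is_linear M).

Lemma ext_mulM M N x : ext_mul M (ext_mul N x) = ext_mul (M *m N) x.
Proof. by apply/ffunP=> F; rewrite !ffunE mulmxA. Qed.

Lemma ext_create_mul i M x :
  ext_create i (ext_mul M x) = ext_mul M (ext_create i x).
Proof.
by apply/ffunP=> F; rewrite !ffunE; case: ifP; rewrite ?mulmx0 // -scalemxAr.
Qed.

Lemma ext_annihil_mul i M x :
  ext_annihil i (ext_mul M x) = ext_mul M (ext_annihil i x).
Proof.
by apply/ffunP=> F; rewrite !ffunE; case: ifP; rewrite ?mulmx0 // -scalemxAr.
Qed.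

Variable T : 'I_k -> 'M[C]_n.

Lemma koszul_diffE x :
  koszul_diff T x = \sum_(i < k) ext_mul (T i) (ext_create i x).
Proof.
apply: eq_bigr => i _; apply/ffunP=> G; rewrite sum_ffunE !ffunE.
case: (boolP (i \in G)) => iG; last first.
  rewrite mulmx0 big1 // => F _; rewrite ffunE wedge_sgen_smon.
  case: ifP => _; rewrite !ffunE ?scale0r //.
  case: eqVneq iG => [->|]; first by rewrite finset.setU11.
  by move=> _ _; rewrite scaler0 scale0r.
(* Wedging with [s_i] reaches the monomial [G] only from [G :\ i]. *)
rewrite (bigD1 (G :\ i)) //= [X in _ + X]big1 => [|F neF].
  rewrite addr0 ffunE wedge_sgen_smon finset.setD11 finset.setD1K // !ffunE.
  rewrite eqxx [_ *: 1]mulr1 -/(koszul_sign C _ _) koszul_signD1 // ltnn mul1r.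
  by rewrite -scalemxAr.
rewrite ffunE wedge_sgen_smon; case: ifPn => iF; rewrite !ffunE ?scale0r //.
case: eqVneq => [defG|]; last by rewrite scaler0 scale0r.
by rewrite defG finset.setU1K ?eqxx // in neF.
Qed.

(** Contraction with the covector [c]; it will be used with [c i = l ^+ i]. *)
Definition koszul_contr (c : 'I_k -> C) x : extmod C n k :=
  \sum_(i < k) c i *: ext_annihil i x.

Lemma koszul_contr_deg (c : 'I_k -> C) (p : int) x :
  ext_deg p x -> ext_deg (p - 1) (koszul_contr c x).
Proof.
move=> dx F; apply: contraNeq => neq_p; rewrite sum_ffunE big1 // => i _.
rewrite !ffunE; case: ifPn => iF; rewrite ?scaler0 //.
have [->|/dx] := eqVneq (x (i |: F)) 0; first by rewrite !scaler0.
by rewrite cardsU1 iF => defp; case/eqP: neq_p; rewrite -defp PoszD addrC addKr.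
Qed.

Lemma koszul_homotopy (c : 'I_k -> C) x :
  koszul_diff T (koszul_contr c x) + koszul_contr c (koszul_diff T x) =
  ext_mul (\sum_i c i *: T i) x.
Proof.
rewrite !koszul_diffE /koszul_contr.
under eq_bigr => i _ do rewrite !linear_sum /=.
under [X in _ + X]eq_bigr => j _ do rewrite linear_sum scaler_sumr /=.
(* Once the two double sums are aligned, the pair [(i, j)] contributes [c j *: T i] applied to the
   anticommutator of [ext_create i] and [ext_annihil j], so only [j = i] remains. *)
rewrite [X in _ + X]exchange_big -big_split /=.
transitivity (\sum_i ext_mul (c i *: T i) x); last first.
  apply/ffunP=> F; rewrite sum_ffunE ffunE mulmx_suml.
  by apply: eq_bigr => i _; rewrite ffunE.
apply: eq_bigr => i _; rewrite -big_split /= (bigD1 i) //= big1 => [|j ne_ji].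
  rewrite addr0 !linearZ /= ext_annihil_mul -scalerDr -linearD ext_CAR eqxx.
  by apply/ffunP=> F; rewrite !ffunE scalemxAl.
rewrite !linearZ /= ext_annihil_mul -scalerDr -linearD ext_CAR.
by rewrite eq_sym (negPf ne_ji) linear0 scaler0.
Qed.

Lemma koszul_diff_mul M x : (forall i, comm_mx M (T i)) ->
  koszul_diff T (ext_mul M x) = ext_mul M (koszul_diff T x).
Proof.
move=> commM; rewrite !koszul_diffE linear_sum; apply: eq_bigr => i _ /=.
by rewrite ext_create_mul !ext_mulM commM.
Qed.

Hypothesis commT : forall i j, comm_mx (T i) (T j).

Lemma koszul_diff_sq x : koszul_diff T (koszul_diff T x) = 0.
Proof.
rewrite !koszul_diffE; under eq_bigr => i _ do rewrite !linear_sum /=.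
pose f i j := ext_mul (T i) (ext_create i (ext_mul (T j) (ext_create j x))).
have fC i j : f i j = - f j i.
  by rewrite /f !ext_create_mul !ext_mulM ext_createC linearN commT.
have f0 i : f i i = 0 by rewrite /f ext_create_mul ext_create_sq !linear0.
(* The diagonal terms vanish, and the others are grouped into pairs that cancel by antisymmetry of
   [f]. *)
transitivity (\sum_(i < k) \sum_(j < k | (j < i)%N) (f i j + f j i)).
  under [RHS]eq_bigr => i _ do rewrite big_split /=.
  rewrite big_split /= [X in _ + X](exchange_big_dep predT) //= -big_split /=.
  apply: eq_bigr => i _; rewrite (bigID (fun j : 'I_k => (j < i)%N)) /=.
  congr (_ + _); rewrite (bigD1 i) ?ltnn //= [X in X + _]f0 add0r.
  by apply: eq_bigl => j; rewrite -val_eqE /=; case: ltngtP.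
by rewrite big1 // => i _; rewrite big1 // => j _; rewrite fC addNr.
Qed.

Lemma koszul_exact_comb (c : 'I_k -> C) :
  \sum_i c i *: T i \in unitmx -> koszul_exact T.
Proof.
set S := \sum_i _ => unitS p _; apply/seteqP; split=> [_ [y dy <-]|x [dx Tx0]].
  split; last exact: koszul_diff_sq.
  by rewrite -[p%:Z](subrK 1); exact: koszul_diff_deg.
have commS i : comm_mx S (T i).
  apply: comm_mx_sym; apply: comm_mx_sum => j _.
  by rewrite /comm_mx -scalemxAl -scalemxAr commT.
(* The inverse of [S] also commutes with each [T i], so it passes through the differential. *)
have commSV i : comm_mx (invmx S) (T i).
  by rewrite /comm_mx -{1}(mulmxK unitS (T i)) -commS -!mulmxA mulKmx.
(* On the cycle [x] the homotopy identity reduces to [koszul_diff T (koszul_contr c x) = ext_mul S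
   x]; dividing by [S] gives a preimage of [x]. *)
exists (ext_mul (invmx S) (koszul_contr c x)).
  move=> F; rewrite ffunE => nzF.
  have /(_ F) := koszul_contr_deg (c := c) dx; apply.
  by apply: contraNneq nzF => ->; rewrite mulmx0.
rewrite koszul_diff_mul //; have := koszul_homotopy c x.
rewrite Tx0 {2}/koszul_contr big1 ?addr0 => [->|i _]; last first.
  by rewrite linear0 scaler0.
by apply/ffunP=> F; rewrite !ffunE mulKmx.
Qed.

End Koszul.

(** * Exactness, common null vectors and singularity *)

Lemma joint_null_not_exact (C : fieldType) n k (T : 'I_k -> 'M[C]_n) :
  joint_null_vector T -> ~ koszul_exact T.
Proof.
move=> [u nz_u Tu0] /(_ 0%N (leq0n k)); rewrite sub0r /koszul_range ext_degN1.
(* [u] sits on the empty monomial: a nonzero cycle of degree 0, while boundaries in that degree come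
   from the null space in degree -1. *)
pose x : extmod C n k := [ffun F => if F == finset.set0 then u else 0].
move=> /seteqP[_ /(_ x)] [].
  split=> [F|].
    by rewrite ffunE; case: (eqVneq F) => [->|]; rewrite ?cards0 ?eqxx.
  rewrite koszul_diffE big1 // => i _; apply/ffunP=> F; rewrite !ffunE.
  case: ifP => _; rewrite ?mulmx0 // -scalemxAr.
  by case: eqP; rewrite ?Tu0 ?mulmx0 scaler0.
move=> _ -> /ffunP/(_ finset.set0); rewrite koszul_diffE big1; last first.
  by move=> i _; rewrite !linear0.
by rewrite !ffunE eqxx => u0; rewrite -u0 eqxx in nz_u.
Qed.

(** Closes a cycle of implications: non-exactness rules out every invertible evaluation (the
    combination with [c i = l ^+ i]), singularity gives a common null vector, and that vector
    obstructs exactness. *)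
Lemma not_koszul_exactP (C : closedFieldType) n k (T : 'I_k -> 'M[C]_n) :
  (forall i j, comm_mx (T i) (T j)) ->
  ~ koszul_exact T <-> matpoly_singular (matpoly T).
Proof.
move=> commT; split=> [nex l | /(matpoly_singularP commT)].
  by apply/negP; rewrite matpoly_evalE => /(koszul_exact_comb commT).
exact: joint_null_not_exact.
Qed.

Theorem mainTheorem3 (R : realType) (n k : nat) (A : 'I_k -> 'M[R[i]]_n)
    (commA : forall i j : 'I_k, comm_mx (A i) (A j)) :
  taylor_spectrum A =
  [set z : 'rV[R[i]]_k |
    matpoly_singular (matpoly (fun i : 'I_k => A i - (z 0 i)%:M))]%classic.
Proof.
have commAz (z : 'rV[R[i]]_k) i j :
    comm_mx (A i - (z 0 i)%:M) (A j - (z 0 j)%:M).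
  apply: comm_mxB; last exact: comm_mx_scalar.
  by apply/comm_mx_sym/comm_mxB => //; exact: comm_mx_scalar.
by apply/seteqP; split=> z /= /(not_koszul_exactP (commAz z)).
Qed.
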